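(* Assume that the smoothness-and-decay condition on $c_{kl}$, the taper condition, the minimal distance condition and the minimal eigenvalue condition (all stated in the context) hold. Assume moreover that for all $\kappa>0$ there exists $\epsilon>0$ such that $$\inf_{\theta\in\Theta,\ |\theta-\theta_0|\ge\kappa}L_\theta-L_{\theta_0}\ \ge\ \epsilon+o_p(1),$$ where the $o_p(1)$ term may depend on $\epsilon$ and $\kappa$ and goes to $0$ in probability as $n\to\infty$. Then, as $n\to\infty$, $$\hat\theta_{\mathrm{ML}}\to\theta_0\quad\text{in probability}\qquad\text{and}\qquad\hat\theta_{t\mathrm{ML}}\to\theta_0\quad\text{in probability}.$$
   Context: Notation. For $x\in\mathbb{R}^m$, $|x|=\max_i|x_i|$ and $\|x\|=\sqrt{\sum_i x_i^2}$. For a symmetric $N\times N$ matrix $A$, $\lambda_1(A)\ge\dots\ge\lambda_N(A)$ are its eigenvalues. $o_p(1)$ denotes a sequence of random variables converging to $0$ in probability as $n\to\infty$. The symbol $\circ$ is the entrywise (Schur) product of matrices and ${}^{\mathsf T}$ is transposition. Setting. Let $d,p,q\in\{1,2,\dots\}$ be fixed. Let $\{Z_k(s): s\in D\subset\mathbb{R}^d,\ k=1,\dots,p\}$ be a $p$-variate stationary Gaussian random process with zero mean, and $Z(s)=(Z_1(s),\dots,Z_p(s))^{\mathsf T}$. Let $\Theta=[\theta_{\inf},\theta_{\sup}]^q$ with $-\infty<\theta_{\inf}<\theta_{\sup}<+\infty$. For each $\theta\in\Theta$, $C(h;\theta)=(c_{kl}(h;\theta))_{k,l=1,\dots,p}$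 is a stationary matrix covariance function on $\mathbb{R}^d$, and there exists $\theta_0\in\Theta$ with $\theta_{\inf}<\theta_{0i}<\theta_{\sup}$ for $i=1,\dots,q$ such that $C(h;\theta_0)=\mathrm{Cov}(Z(s),Z(s+h))$. Let $(t_{kl}(h))_{k,l=1,\dots,p}$ be a stationary taper matrix (covariance) function on $\mathbb{R}^d$, with $t_{kl}(h)=0$ for $\|h\|\ge1$. (A stationary matrix covariance function $(r_{kl})$ is one for which, for any finite set of points $y_1,\dots,y_m$, the $mp\times mp$ matrix with entries $r_{kl}(y_a-y_b)$ in row $(k,a)$ and column $(l,b)$ is symmetric and nonnegative definite.) The process is observed, all $p$ components at the same locations, at distinct points $x_1,\dots,x_n\in D$, where $(x_a)_{a\ge1}$ is a sequence in $\mathbb{R}^d$, and $n\to\infty$. Let $\gamma_n>0$ be the taper range. For $i=(k-1)n+a$ and $j=(l-1)n+b$ with $k,l\in\{1,\dots,p\}$, $a,b\in\{1,\dots,n\}$: $z$ is the $np\times1$ vector with $z_i=Z_k(x_a)$; $\Sigma_\theta$ is the $np\times np$ covariance matrix with $(i,j)$ entry $c_{kl}(x_a-x_b;\theta)$; $T$ is the $np\times np$ taper covariance matrix with $(i,j)$ entry $t_{kl}((x_a-x_b)/\gamma_n)$; and $K_\theta=\Sigma_\theta\circ T$. Define $$L_\theta=\frac1{np}\log\det\Sigma_\theta+\frac1{np}z^{\mathsf T}\Sigma_\theta^{-1}z,\qquad \bar L_\theta=\frac1{np}\log\det K_\theta+\frac1{np}z^{\mathsf T}K_\theta^{-1}z.$$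 The maximum likelihood estimator is any $\hat\theta_{\mathrm{ML}}\in\operatorname{argmin}_{\theta\in\Theta}L_\theta$ and the tapered maximum likelihood estimator is any $\hat\theta_{t\mathrm{ML}}\in\operatorname{argmin}_{\theta\in\Theta}\bar L_\theta$. Conditions. Smoothness-and-decay condition: for all fixed $x\in\mathbb{R}^d$ and $k,l=1,\dots,p$, $c_{kl}(x;\theta)$ is continuously differentiable with respect to $\theta$ on $\Theta$, and there exist constants $A<+\infty$ and $\alpha>0$ such that for all $k,l=1,\dots,p$, $i=1,\dots,q$, $x\in\mathbb{R}^d$, $\theta\in\Theta$, $$|c_{kl}(x;\theta)|\le\frac{A}{1+|x|^{d+\alpha}},\qquad \Bigl|\frac{\partial}{\partial\theta_i}c_{kl}(x;\theta)\Bigr|\le\frac{A}{1+|x|^{d+\alpha}}.$$ Taper condition: for all $k,l=1,\dots,p$, $t_{kl}$ is continuous at $0$, $t_{kl}(0)=1$ and $|t_{kl}(x)|\le1$ for all $x\in\mathbb{R}^d$; and $\gamma_n\to+\infty$ as $n\to\infty$. Minimal distance condition: there exists $\Delta>0$ such that for all $n\ge1$ and all $a\ne b$ in $\{1,\dots,n\}$, $|x_a-x_b|\ge\Delta$. Minimal eigenvalue condition: there exists $\delta>0$ such that for all $n\ge1$ and all $\theta\in\Theta$, $\lambda_{np}(\Sigma_\theta)\ge\delta$ and $\lambda_{np}(K_\theta)\ge\delta$. *)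

(* Defs.v *)
From HB Require Import structures.
From mathcomp Require Import all_boot all_order all_algebra.
From mathcomp Require Import all_classical all_reals all_analysis.

Set Implicit Arguments.
Unset Strict Implicit.
Unset Printing Implicit Defensive.
Import Order.TTheory GRing.Theory Num.Theory.
Import numFieldNormedType.Exports.
Local Open Scope classical_set_scope.
Local Open Scope ring_scope.

(* On 'rV[R]_m the library norm `|x| is max_i |x_i|; eucl_norm is the
   Euclidean norm. *)
Definition eucl_norm (R : realType) (m : nat) (x : 'rV[R]_m) : R :=
  Num.sqrt (\sum_(i < m) x 0 i ^+ 2).

(* The eigenvalues of A with multiplicity, in nonincreasing order. A matrix
   whose characteristic polynomial does not split over R (never the case of a
   symmetric one) gets [::]. *)
Definition eigenvals (R : realType) (N : nat) (A : 'M[R]_N) : seq R :=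
  xget [::] [set s | sorted >=%R s /\
                     char_poly A = \prod_(l <- s) ('X - l%:P)].

(* k is counted from 1: for symmetric A of size N, lambda N A is the smallest
   eigenvalue. *)
Definition lambda (R : realType) (N k : nat) (A : 'M[R]_N) : R :=
  (eigenvals A)`_k.-1.

Definition psdmx (R : realType) (N : nat) (A : 'M[R]_N) : Prop :=
  forall v : 'cV[R]_N, 0 <= (v^T *m A *m v) 0 0.

(* Row and column indices of the np x np matrices are written i = k * n + a,
   with k < p the component and a < n the location (all counted from 0). *)
Lemma component_subproof (p n : nat) (i : 'I_(p * n)) : (i %/ n < p)%N.
Proof.
case: n i => [|n] i; first by case: i => i; rewrite muln0.
by rewrite ltn_divLR.
Qed.

Definition component (p n : nat) (i : 'I_(p * n)) : 'I_p :=
  Ordinal (component_subproof i).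

Definition location (p n : nat) (i : 'I_(p * n)) : nat := (i %% n)%N.

Definition block_cov (R : realType) (d p n : nat) (y : nat -> 'rV[R]_d)
    (r : 'I_p -> 'I_p -> 'rV[R]_d -> R) : 'M[R]_(p * n) :=
  \matrix_(i, j)
    r (component i) (component j) (y (location i) - y (location j)).

Definition stationary_matrix_cov (R : realType) (d p : nat)
    (r : 'I_p -> 'I_p -> 'rV[R]_d -> R) : Prop :=
  forall (m : nat) (y : nat -> 'rV[R]_d),
    block_cov m y r \is symmetricmx /\ psdmx (block_cov m y r).

Section Processes.
Context (dT : measure_display) (T : measurableType dT) (R : realType)
  (P : probability T R) (d p : nat).
Implicit Types (D : set 'rV[R]_d) (Z : 'I_p -> 'rV[R]_d -> {RV P >-> R}).

(* normal_prob m 0 is a junk value in the library, hence the case split. *)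
Definition gaussian_rv (X : T -> R) : Prop :=
  exists m s : R, forall B : set R, measurable B ->
    pushforward P X B = if s == 0 then \d_m B else normal_prob m s B.

Definition gaussian_process D Z : Prop :=
  forall (m : nat) (k : 'I_m -> 'I_p) (s : 'I_m -> 'rV[R]_d) (a : 'I_m -> R),
    (forall i, D (s i)) ->
    gaussian_rv (fun w => \sum_(i < m) a i * Z (k i) (s i) w).

Definition stationary_process D Z : Prop :=
  forall (m : nat) (k : 'I_m -> 'I_p) (s : 'I_m -> 'rV[R]_d) (h : 'rV[R]_d),
    (forall i, D (s i)) -> (forall i, D (s i + h)) ->
    forall B : set (m.-tuple R), measurable B ->
      pushforward P (fun w => [tuple Z (k i) (s i + h) w | i < m]) B =
      pushforward P (fun w => [tuple Z (k i) (s i) w | i < m]) B.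

Definition zero_mean D Z : Prop :=
  forall k s, D s -> ('E_P[Z k s] = 0)%E.

Definition cvg_in_prob (V : normedModType R) (X : nat -> T -> V) (l : V) :
    Prop :=
  forall e : R, 0 < e -> P [set w | e <= `|X n w - l|] @[n --> \oo] --> 0%E.

End Processes.

Definition box (R : realType) (q : nat) (a b : R) : set 'rV[R]_q :=
  [set t | forall i, a <= t 0 i <= b].

(* Partial derivative relative to A: the increments are those that stay in A,
   so that it is one-sided on the faces of a box. *)
Definition partial_quotient (R : realType) (q : nat) (f : 'rV[R]_q -> R)
    (i : 'I_q) (t : 'rV[R]_q) (h : R) : R :=
  h^-1 * (f (t + h *: delta_mx 0 i) - f t).

Definition partial_filter (R : realType) (q : nat) (A : set 'rV[R]_q)
    (i : 'I_q) (t : 'rV[R]_q) : set_system R :=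
  within [set h | A (t + h *: delta_mx 0 i)] (0 : R)^'.

Definition partial_on (R : realType) (q : nat) (A : set 'rV[R]_q)
    (f : 'rV[R]_q -> R) (i : 'I_q) (t : 'rV[R]_q) : R :=
  lim (partial_quotient f i t @ partial_filter A i t).

Definition C1_on (R : realType) (q : nat) (A : set 'rV[R]_q)
    (f : 'rV[R]_q -> R) : Prop :=
  forall i : 'I_q,
    (forall t, A t -> cvg (partial_quotient f i t @ partial_filter A i t)) /\
    {within A, continuous (partial_on A f i)}.

Definition smooth_decay_condition (R : realType) (d p q : nat)
    (Theta : set 'rV[R]_q)
    (c : 'I_p -> 'I_p -> 'rV[R]_d -> 'rV[R]_q -> R) : Prop :=
  (forall k l x, C1_on Theta (c k l x)) /\
  exists A alpha : R, 0 < alpha /\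
    forall (k l : 'I_p) (i : 'I_q) (x : 'rV[R]_d) (t : 'rV[R]_q), Theta t ->
      `|c k l x t| <= A / (1 + `|x| `^ (d%:R + alpha)) /\
      `|partial_on Theta (c k l x) i t| <= A / (1 + `|x| `^ (d%:R + alpha)).

Definition taper_condition (R : realType) (d p : nat)
    (tap : 'I_p -> 'I_p -> 'rV[R]_d -> R) (gamma : nat -> R) : Prop :=
  (forall k l, {for 0, continuous (tap k l)} /\ tap k l 0 = 1 /\
               forall x, `|tap k l x| <= 1) /\
  gamma n @[n --> \oo] --> +oo.

Definition minimal_distance_condition (R : realType) (d : nat)
    (x : nat -> 'rV[R]_d) : Prop :=
  exists Delta : R, 0 < Delta /\
    forall a b : nat, a != b -> Delta <= `|x a - x b|.

Section Likelihood.
Context (R : realType) (d p q : nat).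
Implicit Types (x : nat -> 'rV[R]_d) (gamma : nat -> R)
  (c : 'I_p -> 'I_p -> 'rV[R]_d -> 'rV[R]_q -> R)
  (tap : 'I_p -> 'I_p -> 'rV[R]_d -> R).

Definition Sigma x c (n : nat) (t : 'rV[R]_q) : 'M[R]_(p * n) :=
  block_cov n x (fun k l h => c k l h t).

Definition Taper x tap gamma (n : nat) : 'M[R]_(p * n) :=
  block_cov n x (fun k l h => tap k l ((gamma n)^-1 *: h)).

Definition K x c tap gamma (n : nat) (t : 'rV[R]_q) : 'M[R]_(p * n) :=
  map2_mx *%R (Sigma x c n t) (Taper x tap gamma n).

Definition minimal_eigenvalue_condition (Theta : set 'rV[R]_q) x c tap gamma :
    Prop :=
  exists delta : R, 0 < delta /\
    forall n, (0 < n)%N -> forall t, Theta t ->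
      delta <= lambda (p * n) (Sigma x c n t) /\
      delta <= lambda (p * n) (K x c tap gamma n t).

Definition scaled_nll (N : nat) (S : 'M[R]_N) (z : 'cV[R]_N) : R :=
  N%:R^-1 * ln (\det S) + N%:R^-1 * (z^T *m invmx S *m z) 0 0.

Definition obs (T : Type) x (Z : 'I_p -> 'rV[R]_d -> T -> R) (n : nat)
    (w : T) : 'cV[R]_(p * n) :=
  \col_i Z (component i) (x (location i)) w.

Definition is_argmin (Theta : set 'rV[R]_q) (f : 'rV[R]_q -> R)
    (t : 'rV[R]_q) : Prop :=
  Theta t /\ forall u, Theta u -> f t <= f u.

End Likelihood.

(* Main.v *)
Require Import Defs.
From HB Require Import structures.
From mathcomp Require Import all_boot all_order all_algebra.
From mathcomp Require Import all_classical all_reals all_analysis.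
From mathcomp Require Import measurable_realfun ring lra.

Set Implicit Arguments.
Unset Strict Implicit.
Unset Printing Implicit Defensive.
Import Order.TTheory GRing.Theory Num.Theory.
Import numFieldNormedType.Exports.
Local Open Scope classical_set_scope.
Local Open Scope ring_scope.

(** The maximum likelihood estimator minimizes [L], so where it stays at
    distance [kappa] from [theta0] the identifiability hypothesis forces its
    error term below [- epsilon], an event of vanishing probability. The same
    argument reaches the tapered estimator as soon as the supremum over
    [Theta] of [`|L - Lbar|] tends to [0] in probability.

    That supremum is controlled through [E = Sigma - K], whose entries are
    [c (1 - tap)]. The polynomial decay of [c], uniform in the parameter, is
    summable over points at mutual distance at least [Delta]
    ([packing_sum]), and [1 - tap (h / gamma n)] tends to [0] locally
    uniformly in [h] ([taper_weight]). Hence the row sums of [|E|], which bound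
    the quadratic form of the symmetric matrix [E] ([bform_row_sums]), are
    eventually at most any [eta], for all parameters at once
    ([row_sums_taper]). The uniformity of [`|L - Lbar|] in the parameter is
    inherited from that of the decay of [c].

    Both matrices have smallest eigenvalue at least [delta]
    ([coercive_lambda]). The resolvent identity
    [Sigma^-1 - K^-1 = - Sigma^-1 E K^-1] changes the quadratic term by at most
    [eta delta^-2 |z|^2] ([quad_invmx_close]), and monotonicity of the
    determinant changes the log-determinant by at most [N eta / delta]
    ([ln_det_le]). Altogether [scaled_nll_close] bounds [`|L - Lbar|] by
    [eta (delta^-1 + delta^-2 |z|^2 / N)], where the mean square [|z|^2 / N] of
    the observations has bounded expectation, hence is bounded in probability
    by Markov's inequality ([mean_square_markov]). *)

(** * Quadratic forms and smallest eigenvalues *)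

Section QuadraticForms.
Context (R : realType).
Implicit Types (N : nat) (delta eta : R).

Definition bform N (A : 'M[R]_N) (v w : 'cV[R]_N) : R := (v^T *m A *m w) 0 0.

Definition sqnorm N (v : 'cV[R]_N) : R := \sum_i v i 0 ^+ 2.

Definition coercive delta N (A : 'M[R]_N) : Prop :=
  forall v : 'cV[R]_N, delta * sqnorm v <= bform A v v.

Lemma sqnorm_ge0 N (v : 'cV[R]_N) : 0 <= sqnorm v.
Proof. by apply: sumr_ge0 => i _; exact: sqr_ge0. Qed.

Lemma sqnormE N (v : 'cV[R]_N) : sqnorm v = (v^T *m v) 0 0.
Proof. by rewrite mxE; apply: eq_bigr => i _; rewrite mxE expr2. Qed.

Lemma sqnorm_eq0 N (v : 'cV[R]_N) : (sqnorm v == 0) = (v == 0).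
Proof.
apply/idP/eqP => [|->]; last first.
  by rewrite /sqnorm big1 // => i _; rewrite mxE expr0n.
rewrite psumr_eq0; last by move=> i _; exact: sqr_ge0.
move=> /allP v0; apply/matrixP => i j; rewrite (ord1 j) mxE.
by have := v0 i (mem_index_enum i); rewrite sqrf_eq0 => /eqP.
Qed.

Lemma bformE N (A : 'M[R]_N) v w :
  bform A v w = \sum_i \sum_j v i 0 * A i j * w j 0.
Proof.
rewrite /bform mxE exchange_big; apply: eq_bigr => j _ /=.
by rewrite mxE big_distrl; apply: eq_bigr => i _; rewrite !mxE.
Qed.

Lemma bformDl N (A : 'M[R]_N) u v w :
  bform A (u + v) w = bform A u w + bform A v w.
Proof. by rewrite /bform linearD /= !mulmxDl !mxE. Qed.

Lemma bformDr N (A : 'M[R]_N) u v w :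
  bform A u (v + w) = bform A u v + bform A u w.
Proof. by rewrite /bform mulmxDr !mxE. Qed.

Lemma bformZl N (A : 'M[R]_N) a v w : bform A (a *: v) w = a * bform A v w.
Proof. by rewrite /bform linearZ /= -!scalemxAl mxE. Qed.

Lemma bformZr N (A : 'M[R]_N) a v w : bform A v (a *: w) = a * bform A v w.
Proof. by rewrite /bform -scalemxAr mxE. Qed.

Lemma bformB N (A B : 'M[R]_N) v w :
  bform (A - B) v w = bform A v w - bform B v w.
Proof. by rewrite /bform mulmxBr mulmxBl !mxE. Qed.

Lemma bformZ N (A : 'M[R]_N) a v w : bform (a *: A) v w = a * bform A v w.
Proof. by rewrite /bform -scalemxAr -scalemxAl mxE. Qed.

Lemma bform_scalar N a (v : 'cV[R]_N) : bform a%:M v v = a * sqnorm v.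
Proof. by rewrite /bform sqnormE mul_mx_scalar -scalemxAl mxE. Qed.

Lemma bformC N (A : 'M[R]_N) v w : A^T = A -> bform A v w = bform A w v.
Proof.
move=> sA; rewrite /bform; have <- : (w^T *m A *m v)^T = v^T *m A *m w.
  by rewrite !trmx_mul trmxK sA mulmxA.
by rewrite mxE.
Qed.

(** Schur's test: for a symmetric matrix, [|v_i E_ij w_j|] is at most
    [|E_ij| (v_i^2 + w_j^2) / 2], and both double sums are controlled by the
    row sums. *)
Lemma bform_row_sums N (E : 'M[R]_N) eta v w : E^T = E ->
  (forall i, \sum_j `|E i j| <= eta) ->
  `|bform E v w| <= eta * ((sqnorm v + sqnorm w) / 2).
Proof.
move=> sE rE; rewrite bformE.
have symE i j : E i j = E j i by rewrite -{1}sE mxE.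
apply: (@le_trans _ _ (\sum_i \sum_j
    (`|E i j| * (v i 0 ^+ 2 / 2) + `|E j i| * (w j 0 ^+ 2 / 2)))).
  apply: le_trans (ler_norm_sum _ _ _) _; apply: ler_sum => i _.
  apply: le_trans (ler_norm_sum _ _ _) _; apply: ler_sum => j _.
  rewrite -(symE i j) -mulrDr !normrM mulrAC mulrC ler_wpM2l //.
  rewrite -mulrDl -(real_normK (num_real (v i 0))).
  rewrite -(real_normK (num_real (w j 0))).
  by have := sqr_ge0 (`|v i 0| - `|w j 0|); nra.
under eq_bigr do rewrite big_split /=.
rewrite big_split /= [X in _ + X]exchange_big /=.
rewrite mulrDl mulrDr !mulr_suml !mulr_sumr; apply: lerD; apply: ler_sum => i _.
  by rewrite -mulr_suml ler_wpM2r // divr_ge0 ?sqr_ge0.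
by rewrite -mulr_suml ler_wpM2r // divr_ge0 ?sqr_ge0.
Qed.

Lemma bform_entry_sum N (A : 'M[R]_N) v : A^T = A ->
  `|bform A v v| <= (\sum_i \sum_j `|A i j|) * sqnorm v.
Proof.
move=> sA; have := @bform_row_sums N A (\sum_i \sum_j `|A i j|) v v sA.
have -> : (sqnorm v + sqnorm v) / 2 = sqnorm v by lra.
apply => i.
rewrite [leRHS](bigD1 i) //= lerDl; apply: sumr_ge0 => k _.
by apply: sumr_ge0.
Qed.

Lemma coercive_unitmx delta N (A : 'M[R]_N) :
  0 < delta -> coercive delta A -> A \in unitmx.
Proof.
move=> d0 cA; rewrite -unitmx_tr -row_free_unit -kermx_eq0.
apply/eqP/row_matrixP => i; rewrite row0.
have := sub_kermxP (row_sub i (kermx A^T)); set u := row _ _ => uA.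
have Au : A *m u^T = 0 by rewrite -[A]trmxK -trmx_mul uA trmx0.
have := cA u^T; rewrite /bform -mulmxA Au mulmx0 mxE pmulr_rle0 // => q0.
have : u^T == 0 by rewrite -sqnorm_eq0 eq_le q0 sqnorm_ge0.
by rewrite trmx_eq0 => /eqP.
Qed.

(** The supremum [m] of the [t] for which [A - t] is positive semidefinite
    must make [A - m] singular: for an invertible positive semidefinite [B],
    expanding the form at [v - s B^-1 v] with a small [s] bounds it below by
    a multiple of the squared norm, which leaves room above [m]. So [m] is an
    eigenvalue. *)
Lemma coercive_eigenvalue delta N (A : 'M[R]_N) : A^T = A -> (0 < N)%N ->
  (forall t, eigenvalue A t -> delta <= t) -> coercive delta A.
Proof.
case: N A => // N A sA _ eA.
pose S : set R := [set t | coercive t A].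
have S0 : S !=set0.
  exists (- \sum_i \sum_j `|A i j|) => v; rewrite mulNr lerNl.
  by apply: le_trans (ler_norm _) _; rewrite normrN bform_entry_sum.
have le_quot t v : 0 < sqnorm v -> S t -> t <= bform A v v / sqnorm v.
  by move=> v0 St; rewrite ler_pdivlMr //; exact: St.
have supS : has_sup S.
  split => //; pose v : 'cV[R]_N.+1 := const_mx 1.
  have v0 : 0 < sqnorm v.
    rewrite lt_def sqnorm_ge0 andbT sqnorm_eq0; apply/eqP => /matrixP/(_ 0 0).
    by rewrite !mxE => /eqP; rewrite oner_eq0.
  by exists (bform A v v / sqnorm v) => t; exact: le_quot.
set m := sup S.
have Sm : coercive m A.
  move=> v; have [->|v0] := eqVneq v 0.
    have /eqP -> : sqnorm (0 : 'cV[R]_N.+1) == 0 by rewrite sqnorm_eq0.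
    by rewrite mulr0 /bform mulmx0 mxE.
  have {}v0 : 0 < sqnorm v by rewrite lt_def sqnorm_ge0 andbT sqnorm_eq0.
  by rewrite -ler_pdivlMr //; apply: ge_sup => // t; exact: le_quot.
have [dm v|md] := leP delta m.
  by apply: le_trans (Sm v); rewrite ler_wpM2r // sqnorm_ge0.
pose B := A - m%:M.
have sB : B^T = B by rewrite /B linearB /= tr_scalar_mx sA.
have uB : B \in unitmx.
  apply/negPn/negP => nB; suff /eA : eigenvalue A m by rewrite leNgt md.
  by rewrite /eigenvalue /eigenspace kermx_eq0 row_free_unit.
have BE v : bform B v v = bform A v v - m * sqnorm v.
  by rewrite bformB bform_scalar.
have sV : (invmx B)^T = invmx B by rewrite trmx_inv sB.
(* the added 1 keeps C positive *)
set C := 1 + \sum_i \sum_j `|invmx B i j|.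
have C0 : 0 < C.
  by rewrite ltr_pwDl // sumr_ge0 // => i _; rewrite sumr_ge0.
suff /(sup_upper_bound supS) : S (m + C^-1).
  by rewrite -subr_ge0 opprD addrA subrr sub0r oppr_ge0 invr_le0 leNgt C0.
move=> v; rewrite mulrDl -lerBrDl -BE.
pose w := invmx B *m v.
have Bvw : bform B v w = sqnorm v.
  by rewrite /bform /w -mulmxA mulKVmx // sqnormE.
have Bww : bform B w w <= C * sqnorm v.
  have -> : bform B w w = bform (invmx B) v v.
    by rewrite /bform /w trmx_mul sV mulmxA mulmxKV // ?mulmxA.
  apply: le_trans (ler_norm _) _; apply: le_trans (bform_entry_sum _ sV) _.
  by rewrite ler_wpM2r ?sqnorm_ge0 // lerDr.
have : 0 <= bform B (v + (- C^-1) *: w) (v + (- C^-1) *: w).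
  by rewrite BE subr_ge0; exact: Sm.
rewrite bformDl !bformDr !bformZl !bformZr (bformC w v sB) Bvw => q0.
have : C^-1 * (C^-1 * bform B w w) <= C^-1 * sqnorm v.
  by apply: ler_wpM2l; rewrite ?invr_ge0 ?(ltW C0) // ler_pdivrMl.
move: q0; rewrite !mulNr !mulrN opprK.
set a := C^-1 * sqnorm v; set b := C^-1 * (C^-1 * _); lra.
Qed.

(** A positive lower bound on [lambda N A] excludes the default value [::] of
    [eigenvals], so the characteristic polynomial splits and every eigenvalue
    occurs in the nonincreasing list whose last entry is [lambda N A]. *)
Lemma coercive_lambda delta N (A : 'M[R]_N) : A^T = A -> (0 < N)%N ->
  0 < delta -> delta <= lambda N A -> coercive delta A.
Proof.
move=> sA N0 d0; rewrite /lambda /eigenvals.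
case: xgetP => [s _ [ss cs]|_]; last by rewrite nth_nil leNgt d0.
move=> ds; apply: coercive_eigenvalue => // t.
rewrite eigenvalue_root_char cs root_prod_XsubC => ts.
have szs : size s = N.
  by apply/eqP; rewrite -eqSS -(size_char_poly A) cs size_prod_XsubC.
apply: le_trans ds _; rewrite -(nth_index 0 ts).
have lt_ts : (index t s < N)%N by rewrite -szs index_mem.
apply: (sorted_leq_nth (rev_trans le_trans) (@lexx _ R) 0 ss).
- by rewrite inE index_mem.
- by rewrite inE szs prednK.
- by rewrite -ltnS prednK.
Qed.

(** * Determinants and the Loewner order *)

Definition schur_complement N (A : 'M[R]_(1 + N)) : 'M[R]_N :=
  drsubmx A - (A 0 0)^-1 *: (dlsubmx A *m ursubmx A).

Lemma det_schur N (A : 'M[R]_(1 + N)) : A 0 0 != 0 ->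
  \det A = A 0 0 * \det (schur_complement A).
Proof.
move=> a0; set a := A 0 0.
have ulA : ulsubmx A = a%:M by rewrite [LHS]mx11_scalar !mxE !lshift0.
have LU : A = block_mx 1%:M 0 (a^-1 *: dlsubmx A) 1%:M *m
              block_mx a%:M (ursubmx A) 0 (schur_complement A).
  rewrite mulmx_block !mul1mx !mul0mx !addr0 mul_mx_scalar scalerA.
  rewrite mulfV // scale1r -scalemxAl /schur_complement addrC subrK.
  by rewrite -ulA submxK.
by rewrite {1}LU det_mulmx det_lblock det_ublock !det1 !mul1r det_scalar1.
Qed.

Lemma tr_schur N (A : 'M[R]_(1 + N)) : A^T = A ->
  (schur_complement A)^T = schur_complement A.
Proof.
move=> sA; rewrite /schur_complement linearB linearZ /= trmx_mul.
by rewrite trmx_drsub trmx_ursub trmx_dlsub sA.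
Qed.

(** Completing the square in the first coordinate [x]; when [A 0 0 > 0], the
    minimum over [x] is the form of the Schur complement. *)
Lemma bform_schur N (A : 'M[R]_(1 + N)) x v : A^T = A -> A 0 0 != 0 ->
  bform A (col_mx (x%:M : 'M[R]_1) v) (col_mx x%:M v) =
  A 0 0 * (x + (A 0 0)^-1 * (ursubmx A *m v) 0 0) ^+ 2 +
  bform (schur_complement A) v v.
Proof.
move=> sA a0; set a := A 0 0 in a0 *; set s := (ursubmx A *m v) 0 0.
have ulA : ulsubmx A = a%:M by rewrite [LHS]mx11_scalar !mxE !lshift0.
have uv : ursubmx A *m v = s%:M by rewrite [LHS]mx11_scalar.
have vd : v^T *m dlsubmx A = s%:M.
  by rewrite -[dlsubmx A]trmxK -trmx_mul trmx_dlsub sA uv tr_scalar_mx.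
rewrite /bform /schur_complement mulmxBr mulmxBl.
rewrite -scalemxAr -scalemxAl !mulmxA vd.
rewrite -(mulmxA s%:M) uv.
rewrite -{1}[A]submxK ulA tr_col_mx mul_row_block mul_row_col tr_scalar_mx.
rewrite !mulmxDl -!mulmxA uv (mulmxA v^T (dlsubmx A)) vd -/a.
rewrite !(mul_mx_scalar, scale_scalar_mx) !mxE !mulr1n.
by field.
Qed.

(** Loewner monotonicity of the determinant. The Schur complement of [A] has as
    quadratic form the partial minimum [v |-> min_x bform A (x, v) (x, v)], so
    the order passes to Schur complements; the top left entries are ordered as
    well, and the determinant is their product. *)
Lemma det_monotone N (A B : 'M[R]_N) : A^T = A -> B^T = B ->
  (forall v, v != 0 -> 0 < bform A v v) ->
  (forall v, bform A v v <= bform B v v) -> 0 < \det A <= \det B.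
Proof.
elim: N A B => [|N IH] A B sA sB A0 AB; first by rewrite !det_mx00 ltr01 lexx.
change N.+1 with (1 + N)%N in A, B, sA, sB, A0, AB |- *.
have entry00 (M : 'M[R]_(1 + N)) :
    M 0 0 = bform M (col_mx 1%:M 0) (col_mx 1%:M 0).
  rewrite /bform tr_col_mx -{2}[M]submxK mul_row_block mul_row_col.
  rewrite !trmx0 !mul0mx !addr0 mulmx0 addr0 trmx1 mul1mx mulmx1.
  by rewrite !mxE !lshift0.
have a0 : 0 < A 0 0.
  rewrite entry00 A0 //; apply/eqP => /(congr1 usubmx)/matrixP/(_ 0 0).
  by rewrite col_mxKu !mxE => /eqP; rewrite oner_eq0.
have ab : A 0 0 <= B 0 0 by rewrite !entry00.
have b0 := lt_le_trans a0 ab.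
have minE (M : 'M[R]_(1 + N)) v : M^T = M -> 0 < M 0 0 ->
    bform (schur_complement M) v v =
    bform M (col_mx (- ((M 0 0)^-1 * (ursubmx M *m v) 0 0))%:M v)
            (col_mx (- ((M 0 0)^-1 * (ursubmx M *m v) 0 0))%:M v).
  by move=> sM M0; rewrite bform_schur ?gt_eqF // addNr expr0n mulr0 add0r.
have /andP[dA dAB] : 0 < \det (schur_complement A) <= \det (schur_complement B).
  apply: IH => [||v v0|v]; [exact: tr_schur|exact: tr_schur| |].
    rewrite minE // A0 //; apply: contraNneq v0 => /(congr1 dsubmx).
    by rewrite col_mxKd linear0 => ->.
  rewrite (minE B) //; apply: le_trans (AB _).
  rewrite (bform_schur _ _ sA) ?gt_eqF // lerDr.
  by rewrite mulr_ge0 ?sqr_ge0 // ltW.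
rewrite !det_schur ?gt_eqF // mulr_gt0 //= ler_pM // ltW //.
Qed.

(** The quadratic form of [B] is at most [1 + eta / delta] times that of [A],
    so its determinant is at most the [N]-th power of that factor times
    [\det A]. *)
Lemma ln_det_le delta eta N (A B : 'M[R]_N) : A^T = A -> B^T = B ->
  0 < delta -> 0 <= eta -> coercive delta A -> coercive delta B ->
  (forall i, \sum_j `|(B - A) i j| <= eta) ->
  ln (\det B) - ln (\det A) <= N%:R * (eta / delta).
Proof.
move=> sA sB d0 e0 cA cB rAB.
have pos M : coercive delta M -> forall v : 'cV[R]_N, v != 0 -> 0 < bform M v v.
  move=> cM v v0; apply: lt_le_trans (cM v).
  by rewrite mulr_gt0 // lt_def sqnorm_ge0 andbT sqnorm_eq0.
have k0 : 0 < 1 + eta / delta by rewrite ltr_pwDl // divr_ge0 // ltW.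
have A0 : 0 < \det A.
  by have /andP[] := det_monotone sA sA (pos A cA) (fun v => lexx _).
have sAB : (B - A)^T = B - A by rewrite linearB /= sA sB.
have /andP[B0 BA] : 0 < \det B <= \det ((1 + eta / delta) *: A).
  apply: det_monotone => //; [by rewrite linearZ /= sA|exact: pos|move=> v].
  rewrite bformZ mulrDl mul1r addrC -lerBlDr -bformB.
  apply: le_trans (ler_norm _) _.
  apply: le_trans (bform_row_sums v v sAB rAB) _.
  have -> : (sqnorm v + sqnorm v) / 2 = sqnorm v by lra.
  by rewrite -mulrA ler_wpM2l // ler_pdivlMl //; exact: cA.
move: BA; rewrite detZ -ler_ln ?posrE ?mulr_gt0 ?exprn_gt0 //.
rewrite lnM ?posrE ?exprn_gt0 // lnXn // => BA.
rewrite lerBlDr; apply: le_trans BA _; rewrite lerD2r -[_ *+ N]mulr_natl.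
rewrite ler_wpM2l ?ler0n // le_ln1Dx // (lt_le_trans (ltrN10 R)) //.
by rewrite divr_ge0 // ltW.
Qed.

(** With [v = A^-1 z] and [w = B^-1 z], the difference of the two quadratic
    forms is [bform (B - A) v w], and coercivity gives
    [|v|, |w| <= |z| / delta]. *)
Lemma quad_invmx_close delta eta N (A B : 'M[R]_N) z : A^T = A -> B^T = B ->
  0 < delta -> 0 <= eta -> coercive delta A -> coercive delta B ->
  (forall i, \sum_j `|(B - A) i j| <= eta) ->
  `|bform (invmx A) z z - bform (invmx B) z z|
    <= eta * (delta ^- 2 * sqnorm z).
Proof.
move=> sA sB d0 e0 cA cB rAB.
have uA := coercive_unitmx d0 cA; have uB := coercive_unitmx d0 cB.
have bound M : coercive delta M -> M \in unitmx ->
    sqnorm (invmx M *m z) <= delta ^- 2 * sqnorm z.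
  move=> cM uM; set v := invmx M *m z.
  have := cM v; rewrite /bform -mulmxA mulKVmx //.
  (* delta |v|^2 <= v^T z, and 2 delta v^T z <= |z|^2 + delta^2 |v|^2 *)
  have := sqnorm_ge0 (z - delta *: v).
  have -> : sqnorm (z - delta *: v) =
      sqnorm z - 2 * delta * (v^T *m z) 0 0 + delta ^+ 2 * sqnorm v.
    rewrite /sqnorm mxE !mulr_sumr -sumrB -big_split /=.
    by apply: eq_bigr => i _; rewrite !mxE; ring.
  set s := (v^T *m z) 0 0; set y := sqnorm v => h1 h2.
  rewrite ler_pdivlMl ?exprn_gt0 // expr2.
  have : delta * (delta * y) <= delta * s by rewrite ler_pM2l.
  by move: h1; rewrite expr2; lra.
have -> : bform (invmx A) z z - bform (invmx B) z z =
          bform (B - A) (invmx A *m z) (invmx B *m z).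
  rewrite bformB /bform trmx_mul trmx_inv sA -!mulmxA.
  by rewrite mulKVmx // mulKmx.
apply: le_trans (bform_row_sums _ _ _ rAB) _; first by rewrite linearB /= sA sB.
rewrite ler_wpM2l // ler_pdivrMr // mulr_natr mulr2n.
by apply: lerD; exact: bound.
Qed.

Lemma scaled_nll_close delta eta N (A B : 'M[R]_N) z : A^T = A -> B^T = B ->
  0 < delta -> 0 <= eta -> coercive delta A -> coercive delta B ->
  (forall i, \sum_j `|(A - B) i j| <= eta) ->
  `|scaled_nll A z - scaled_nll B z|
    <= eta * (delta^-1 + delta ^- 2 * (N%:R^-1 * sqnorm z)).
Proof.
move=> sA sB d0 e0 cA cB rAB.
have rBA i : \sum_j `|(B - A) i j| <= eta.
  apply: le_trans (rAB i); apply: ler_sum => j _.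
  by rewrite -opprB mxE normrN.
have N0 : 0 <= (N%:R : R)^-1 by rewrite invr_ge0 ler0n.
have lnAB : `|ln (\det A) - ln (\det B)| <= N%:R * (eta / delta).
  rewrite ler_norml lerNl opprB (ln_det_le sA sB d0 e0) //=.
  exact: (ln_det_le sB sA d0 e0).
rewrite /scaled_nll -/(bform (invmx A) z z) -/(bform (invmx B) z z).
rewrite opprD addrACA -!mulrBr [leRHS]mulrDr.
apply: le_trans (ler_normD _ _) _; rewrite !normrM (ger0_norm N0).
apply: lerD; last first.
  rewrite (mulrCA (delta ^- 2)) (mulrCA eta) ler_wpM2l //.
  exact: quad_invmx_close.
apply: (@le_trans _ _ (N%:R^-1 * (N%:R * (eta / delta)))).
  by rewrite ler_wpM2l.
have [->|n0] := eqVneq N 0%N.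
  by rewrite invr0 !mul0r divr_ge0 // ltW.
by rewrite mulKf // pnatr_eq0.
Qed.

End QuadraticForms.

(** * Sums over separated points *)

Section Packing.
Context (R : realType).

(** Since [(u/v)^-b = exp (- b ln (u/v)) >= 1 + b (1 - u/v)], the summand
    [v^-(b+1)] is dominated by a telescoping difference of [-b]-th powers. *)
Lemma powR_telescope (u v b : R) : 0 < u -> 0 < v -> 0 <= b ->
  b * (v - u) * v `^ (- (b + 1)) <= u `^ (- b) - v `^ (- b).
Proof.
move=> u0 v0 b0.
have -> : v `^ (- (b + 1)) = v `^ (- b) / v.
  rewrite opprD powRD; last by apply/implyP => _; rewrite gt_eqF.
  by rewrite powR_inv1 // ltW.
have -> : u `^ (- b) = v `^ (- b) * (u / v) `^ (- b).
  rewrite -powRM ?divr_ge0 // ?ltW //; congr (_ `^ _); field.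
  by rewrite gt_eqF.
have uv0 : 0 < u / v by rewrite divr_gt0.
have le_uv : 1 + b * (1 - u / v) <= (u / v) `^ (- b).
  rewrite /powR gt_eqF //; apply: le_trans (expR_ge1Dx _).
  rewrite lerD2l mulNr -mulrN ler_wpM2l // lerNr opprB.
  have -> : u / v = 1 + (u / v - 1) by ring.
  by rewrite [leRHS]addrAC subrr add0r le_ln1Dx // ltrBDr addNr.
have -> : b * (v - u) * (v `^ (- b) / v) = v `^ (- b) * (b * (1 - u / v)).
  by field; rewrite gt_eqF.
rewrite -{3}[v `^ _]mulr1 -mulrBr ler_wpM2l ?powR_ge0 //.
by rewrite lerBrDl.
Qed.

(** With [b = r - 1], the telescoping bound sums to [1 / (b Delta)] over
    [k > 0]; the leading [1] is the term [k = 0]. *)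
Lemma sum_powR_bounded (r Delta : R) (n : nat) : 1 < r -> 0 < Delta ->
  \sum_(k < n) (1 + Delta * k%:R) `^ (- r) <= 1 + ((r - 1) * Delta)^-1.
Proof.
move=> r1 D0; have b0 : 0 < r - 1 by rewrite subr_gt0.
have bD0 : 0 < (r - 1) * Delta by rewrite mulr_gt0.
pose u k : R := 1 + Delta * k%:R.
have u0 k : 0 < u k by rewrite /u ltr_pwDl // mulr_ge0 // ltW.
suff partial k : (r - 1) * Delta * \sum_(i < k.+1) u i `^ (- r) <=
    (r - 1) * Delta + (1 - u k `^ (- (r - 1))).
  case: n => [|n]; first by rewrite big_ord0 addr_ge0 // invr_ge0 ltW.
  rewrite -(ler_pM2l bD0) mulrDr mulr1 divff ?gt_eqF //.
  apply: le_trans (partial n) _; rewrite lerD2l gerBl; exact: powR_ge0.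
elim: k => [|k IH].
  by rewrite big_ord_recl big_ord0 /u mulr0 !addr0 !powR1 mulr1 subrr addr0.
rewrite big_ord_recr /= mulrDr.
have := powR_telescope (u0 k) (u0 k.+1) (ltW b0); rewrite subrK.
have -> : u k.+1 - u k = Delta by rewrite /u -natr1; ring.
by move: IH; lra.
Qed.

(** Points at mutual distance at least [Delta] lie in distinct cells of the
    grid of mesh [Delta], and a cell is described by one sign and one natural
    number per coordinate. As [(1 + |y|)^-(d r)] is at most the product of the
    [(1 + |y_i|)^-r], the sum over the points is at most a sum over cells of
    products, which factors into [d] one-dimensional sums. *)
Lemma packing_sum (d : nat) (I : finType) (Q : pred I) (y : I -> 'rV[R]_d)
    (r Delta : R) : 1 < r -> 0 < Delta ->
  {in Q &, forall a b, a != b -> Delta <= `|y a - y b|} ->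
  \sum_(b | Q b) (1 + `|y b|) `^ (- (r *+ d))
    <= (2 * (1 + ((r - 1) * Delta)^-1)) ^+ d.
Proof.
move=> r1 D0 sep.
pose cell b i := Num.truncn (`|y b 0 i| / Delta).
pose m := \max_b \max_i cell b i.
have cell_m b i : (cell b i < m.+1)%N.
  rewrite ltnS (leq_trans (leq_bigmax i)) //.
  exact: (leq_bigmax (F := fun b => \max_i cell b i)).
pose code b : {ffun 'I_d -> bool * 'I_m.+1} :=
  [ffun i => (y b 0 i < 0, inord (cell b i))].
pose phi (c : bool * 'I_m.+1) : R := (1 + Delta * c.2%:R) `^ (- r).
have cell_itv b i :
    Delta * (cell b i)%:R <= `|y b 0 i| < Delta * (cell b i)%:R + Delta.
  have /truncn_itv : 0 <= `|y b 0 i| / Delta by rewrite divr_ge0 // ltW.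
  by rewrite ler_pdivlMr // ltr_pdivrMr // -natr1 mulrDl mul1r !(mulrC _ Delta).
have code_inj : {in Q &, injective code}.
  move=> a b Qa Qb ab; apply/eqP/negPn/negP => /(sep _ _ Qa Qb).
  rewrite leNgt => /negP; apply.
  rewrite [ltLHS]mx_normrE.
  apply/bigmax_ltP; split => // -[i0 i] _ /=.
  rewrite (ord1 i0) !mxE.
  have := congr1 (fun f : {ffun 'I_d -> bool * 'I_m.+1} => f i) ab.
  rewrite !ffunE => -[sg /(congr1 val)]; rewrite /= !inordK // => cl.
  have := cell_itv a i; have := cell_itv b i; rewrite cl.
  set t := Delta * _ => /andP[b1 b2] /andP[a1 a2].
  move: sg b1 b2 a1 a2; have [a0|a0] := ltP (y a 0 i) 0;
    have [b0|b0] := ltP (y b 0 i) 0 => // _.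
    rewrite (ltr0_norm a0) (ltr0_norm b0) ltr_norml => *.
    apply/andP; split; lra.
  rewrite (ger0_norm a0) (ger0_norm b0) ltr_norml => *.
  apply/andP; split; lra.
have decay b : (1 + `|y b|) `^ (- (r *+ d)) <= \prod_i phi (code b i).
  have le1 (v : R) : 0 <= v -> 0 < 1 + v by move=> v0; rewrite ltr_pwDl.
  rewrite powRN -mulr_natr powRrM powR_mulrn ?powR_ge0 // -exprVn -powRN.
  rewrite -[X in _ ^+ X]card_ord -prodr_const; apply: ler_prod => i _.
  rewrite powR_ge0 /phi ffunE /= inordK // !powRN.
  rewrite lef_pV2 ?posrE ?powR_gt0 ?le1 //; last by rewrite mulr_ge0 // ltW.
  apply: ge0_ler_powR; rewrite ?nnegrE ?(ltW (le1 _ _)) // ?lerD2l.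
  - by rewrite ltW // (lt_trans ltr01).
  - by rewrite mulr_ge0 // ltW.
  have /andP[/le_trans-> //] := cell_itv b i.
  by rewrite [leRHS]mx_normrE (le_bigmax _ _ (0, i)).
apply: (@le_trans _ _ (\sum_(b | Q b) \prod_i phi (code b i))).
  exact: ler_sum.
pose weight (f : {ffun 'I_d -> bool * 'I_m.+1}) := \prod_i phi (f i).
have weight0 f : 0 <= weight f by apply: prodr_ge0 => i _; exact: powR_ge0.
rewrite -(big_imset weight code_inj) /=.
apply: (@le_trans _ _ (\sum_f weight f)).
  by rewrite big_mkcond; apply: ler_sum => f _; case: ifP.
rewrite -(bigA_distr_bigA (fun _ => phi)) prodr_const card_ord.
rewrite lerXn2r ?nnegrE //.
- by apply: sumr_ge0 => c _; exact: powR_ge0.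
- by rewrite mulr_ge0 // addr_ge0 // invr_ge0 mulr_ge0 // ?subr_ge0 ltW.
rewrite -(pair_bigA _ (fun s k => phi (s, k))) big_bool mulrDl mul1r /=.
by apply: lerD; exact: sum_powR_bounded.
Qed.

End Packing.

(** * Uniform decay of the tapering error *)

Section Taper.
Context (R : realType) (d p q : nat).

Lemma decay_powRN (A s r : R) : 0 <= A -> 0 <= s -> 0 <= r ->
  A / (1 + r `^ s) <= A * 2 `^ s * (1 + r) `^ (- s).
Proof.
move=> A0 s0 r0; rewrite -mulrA ler_wpM2l // powRN ler_pdivlMr; last first.
  by rewrite powR_gt0 // ltr_pwDl.
(* 1 + r <= 2 max(1, r) *)
have le_max : (1 + r) `^ s <= 2 `^ s * (1 + r `^ s).
  have -> : 1 + r `^ s = (1 : R) `^ s + r `^ s by rewrite powR1.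
  have [r1|r1] := leP r 1.
    apply: (@le_trans _ _ (2 `^ s * 1 `^ s)); last first.
      by rewrite ler_wpM2l ?powR_ge0 // lerDl powR_ge0.
    rewrite powR1 mulr1 ge0_ler_powR ?nnegrE ?addr_ge0 //.
    by rewrite (_ : 2 = 1 + 1) // lerD2l.
  apply: (@le_trans _ _ (2 `^ s * r `^ s)); last first.
    by rewrite ler_wpM2l ?powR_ge0 // lerDr powR_ge0.
  rewrite -powRM // ge0_ler_powR ?nnegrE ?addr_ge0 ?mulr_ge0 //.
  by rewrite mulr_natl mulr2n lerD2r ltW.
rewrite mulrC ler_pdivrMr //.
by rewrite ltr_pwDl // powR_ge0.
Qed.

(** Away from the origin the factor [(1 + |h|)^-e] is small while the taper is
    bounded; on a fixed ball [h / gamma n] tends to [0] uniformly, and there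
    the taper is close to its value [1] at the origin. *)
Lemma taper_weight (f : 'rV[R]_d -> R) (gamma : nat -> R) (e tau : R) :
  {for 0, continuous f} -> f 0 = 1 -> (forall h, `|f h| <= 1) ->
  (forall n, 0 < gamma n) -> gamma n @[n --> \oo] --> +oo ->
  0 < e -> 0 < tau ->
  \forall n \near \oo, forall h : 'rV[R]_d,
    (1 + `|h|) `^ (- e) * `|1 - f ((gamma n)^-1 *: h)| <= tau.
Proof.
move=> cf f0 f1 g0 goo e0 tau0.
pose M := (2 / tau) `^ e^-1.
have /cvgrPdist_le/(_ _ tau0)/nbhs_normP[rho /= rho0 frho] := cf.
rewrite f0 in frho.
near=> n => h.
have le1 (r : R) : 0 <= r -> 1 <= (1 + r) `^ e.
  by move=> r0; rewrite -[leLHS](powRr0 (1 + r)) ler_powR ?lerDl // ltW.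
have h1 := le1 _ (normr_ge0 h).
have h0 := lt_le_trans ltr01 h1.
rewrite powRN mulrC ler_pdivrMr //.
have [hM|hM] := leP `|h| M.
  apply: (@le_trans _ _ tau); last by rewrite ler_peMr // ltW.
  apply: frho; rewrite /= sub0r normrN normrZ gtr0_norm ?invr_gt0 //.
  rewrite ltr_pdivrMl //; apply: le_lt_trans hM _.
  by rewrite -ltr_pdivrMr //; near: n; exact: cvgry_gt.
apply: (@le_trans _ _ 2).
  apply: le_trans (ler_normB _ _) _.
  by rewrite normr1 (_ : 2 = 1 + 1) // lerD2l.
rewrite -ler_pdivrMl //.
have -> : tau^-1 * 2 = M `^ e.
  rewrite /M -powRrM mulVf ?gt_eqF // powRr1 ?divr_ge0 // ?ltW //.
  by rewrite mulrC.
apply: ge0_ler_powR; rewrite ?nnegrE ?powR_ge0 ?addr_ge0 ?(ltW e0) //.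
by rewrite ltW // (lt_trans hM) // ltrDr.
Unshelve. all: by end_near. Qed.

(** The decay [(1 + |h|)^-(d + alpha)] is split as
    [(1 + |h|)^-(alpha / 2) (1 + |h|)^-(d + alpha / 2)]: the first factor
    absorbs the taper error uniformly in [h], the second one is still summable
    over separated points. The bound does not involve [t]. *)
Lemma row_sums_taper (Theta : set 'rV[R]_q) (x : nat -> 'rV[R]_d)
    (c : 'I_p -> 'I_p -> 'rV[R]_d -> 'rV[R]_q -> R)
    (tap : 'I_p -> 'I_p -> 'rV[R]_d -> R) (gamma : nat -> R) (eta : R) :
  (0 < d)%N -> (0 < q)%N -> (forall n, 0 < gamma n) ->
  smooth_decay_condition Theta c -> taper_condition tap gamma ->
  minimal_distance_condition x -> 0 < eta ->
  \forall n \near \oo, forall t, Theta t -> forall i,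
    \sum_j `|(Sigma x c n t - K x c tap gamma n t) i j| <= eta.
Proof.
move=> d0 q0 g0 [_ [A [alpha [al0 decay]]]] [ctap goo] [Delta [D0 sep]] eta0.
have dR : 0 < d%:R :> R by rewrite ltr0n.
pose A' := `|A| * 2 `^ (d%:R + alpha).
have A'0 : 0 <= A' by rewrite mulr_ge0 ?powR_ge0.
pose r := 1 + alpha / 2 / d%:R.
have r1 : 1 < r by rewrite ltrDl !divr_gt0.
have rd : r *+ d = d%:R + alpha / 2.
  by rewrite -mulr_natr mulrDl mul1r mulfVK // gt_eqF.
pose C : R := (2 * (1 + ((r - 1) * Delta)^-1)) ^+ d.
have C0 : 0 <= C.
  rewrite exprn_ge0 // mulr_ge0 // addr_ge0 // invr_ge0.
  by rewrite mulr_ge0 ?subr_ge0 ?ltW.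
pose B := 1 + A' * (C *+ p).
have B0 : 0 < B by rewrite ltr_pwDl // mulr_ge0 // mulrn_wge0.
pose tau := eta / B.
have tau0 : 0 < tau by rewrite divr_gt0.
have wt : \forall n \near \oo, forall k l h,
    (1 + `|h|) `^ (- (alpha / 2)) * `|1 - tap k l ((gamma n)^-1 *: h)| <= tau.
  apply: filter_forall => k; apply: filter_forall => l.
  have [cf [f0 f1]] := ctap k l.
  by apply: taper_weight => //; rewrite divr_gt0.
near=> n => t Tt i.
have wtn : forall k l h,
    (1 + `|h|) `^ (- (alpha / 2)) * `|1 - tap k l ((gamma n)^-1 *: h)| <= tau.
  by near: n.
pose y (j : 'I_(p * n)) := x (location i) - x (location j).
have entry j : `|(Sigma x c n t - K x c tap gamma n t) i j|
    <= A' * tau * (1 + `|y j|) `^ (- (r *+ d)).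
  rewrite !mxE -/(y j) -{1}[c _ _ _ _]mulr1 -mulrBr normrM.
  set k := component i; set l := component j; set h := y j.
  have [ck _] := decay k l (Ordinal q0) h t Tt.
  have h0 : 0 < 1 + `|h| by rewrite ltr_pwDl.
  have {}ck : `|c k l h t| <=
      A' * (1 + `|h|) `^ (- (r *+ d)) * (1 + `|h|) `^ (- (alpha / 2)).
    apply: le_trans ck _.
    apply: (@le_trans _ _ (`|A| / (1 + `|h| `^ (d%:R + alpha)))).
      by rewrite ler_wpM2r ?ler_norm // invr_ge0 addr_ge0 ?powR_ge0.
    apply: le_trans (decay_powRN _ _ _) _ => //.
      by rewrite addr_ge0 ?ler0n // ltW.
    rewrite -[leRHS]mulrA -powRD; last by apply/implyP => _; rewrite gt_eqF.
    by rewrite rd -opprD -addrA -splitr.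
  apply: le_trans (ler_wpM2r (normr_ge0 _) ck) _.
  by rewrite -(mulrA (A' * _)) [leRHS]mulrAC ler_wpM2l // mulr_ge0 // powR_ge0.
apply: le_trans (ler_sum _ (fun j _ => entry j)) _.
rewrite -mulr_sumr.
rewrite (partition_big (@component p n) xpredT) //=.
(* j ranges over all components and locations; within one component distinct
   indices have distinct, hence separated, locations *)
have block k : \sum_(j | component j == k) (1 + `|y j|) `^ (- (r *+ d)) <= C.
  apply: (@packing_sum _ _ _ _ _ _ Delta) => // a b /eqP ka /eqP kb ab.
  rewrite /y opprB addrC addrA subrK; apply: sep; apply: contra ab => /eqP lab.
  have := congr1 val ka; rewrite -kb /= => kab; apply/eqP/val_inj => /=.
  by rewrite (divn_eq a n) (divn_eq b n) kab -/(location a) -lab.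
apply: (@le_trans _ _ (A' * tau * \sum_(k < p) C)).
  by rewrite ler_wpM2l ?(mulr_ge0 A'0 (ltW tau0)) //; apply: ler_sum => k _.
rewrite sumr_const card_ord mulrAC /tau mulrA ler_pdivrMr // mulrC.
by rewrite ler_wpM2l ?(ltW eta0) // /B lerDr.
Unshelve. all: by end_near. Qed.

End Taper.

Section Covariances.
Context (R : realType) (d p q : nat).

Lemma trmx_symmetric N (A : 'M[R]_N) : A \is symmetricmx -> A^T = A.
Proof. by move=> /is_hermitianmxP; rewrite expr0 scale1r map_mx_id. Qed.

Lemma scaled_nll_taper_close (x : nat -> 'rV[R]_d)
    (c : 'I_p -> 'I_p -> 'rV[R]_d -> 'rV[R]_q -> R)
    (tap : 'I_p -> 'I_p -> 'rV[R]_d -> R) (gamma : nat -> R) (delta eta : R)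
    (n : nat) (t : 'rV[R]_q) (z : 'cV[R]_(p * n)) :
  (0 < p)%N -> (0 < n)%N ->
  stationary_matrix_cov (fun k l h => c k l h t) ->
  stationary_matrix_cov tap ->
  0 < delta -> delta <= lambda (p * n) (Sigma x c n t) ->
  delta <= lambda (p * n) (K x c tap gamma n t) -> 0 <= eta ->
  (forall i, \sum_j `|(Sigma x c n t - K x c tap gamma n t) i j| <= eta) ->
  `|scaled_nll (Sigma x c n t) z - scaled_nll (K x c tap gamma n t) z|
    <= eta * (delta^-1 + delta ^- 2 * ((p * n)%:R^-1 * sqnorm z)).
Proof.
move=> p0 n0 covc covt d0 dS dK e0 rows.
have N0 : (0 < p * n)%N by rewrite muln_gt0 p0 n0.
have sS : (Sigma x c n t)^T = Sigma x c n t.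
  by apply: trmx_symmetric; have [] := covc n x.
have sT : (Taper x tap gamma n)^T = Taper x tap gamma n.
  (* tapering at range gamma amounts to sampling the taper at rescaled points *)
  apply: trmx_symmetric; have [+ _] := covt n (fun a => (gamma n)^-1 *: x a).
  congr (_ \is _); apply/matrixP => i j; rewrite !mxE.
  by rewrite scalerBr.
have sK : (K x c tap gamma n t)^T = K x c tap gamma n t.
  by rewrite map2_trmx sS sT.
apply: scaled_nll_close => //; exact: coercive_lambda.
Qed.

End Covariances.

(** * Convergence in probability *)

Section Probability.
Context (dT : measure_display) (T : measurableType dT) (R : realType).
Context (P : probability T R).

Lemma measurable_ge (f : T -> R) e :
  measurable_fun setT f -> measurable [set w | e <= f w].
Proof.
move=> mf; have := mf measurableT _ (measurable_itv `[e, +oo[).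
rewrite setTI; congr measurable; apply/seteqP.
by split=> w /=; rewrite in_itv /= andbT.
Qed.

Lemma measurable_dist (q : nat) (X : T -> 'rV[R]_q) (l : 'rV[R]_q) :
  (forall i, measurable_fun setT (fun w => X w 0 i)) ->
  measurable_fun setT (fun w => `|X w - l|).
Proof.
move=> mX; under eq_fun do rewrite [`|_|]mx_normrE.
elim: (index_enum _) => [|ij s IH].
  by under eq_fun do rewrite big_nil; exact: measurable_cst.
under eq_fun do rewrite big_cons; apply: measurable_maxr => //.
apply: measurableT_comp => //; under eq_fun do rewrite !mxE.
by rewrite (ord1 ij.1); apply: measurable_funB => //; exact: mX.
Qed.

Lemma mean_square_markov N (X : 'I_N -> {RV P >-> R}) (M a : R) :
  0 <= M -> 0 < a -> (forall i, (\int[P]_w (X i w ^+ 2)%:E <= M%:E)%E) ->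
  (P [set w | (a <= N%:R^-1 * \sum_i X i w ^+ 2)%R] <= (M / a)%:E)%E.
Proof.
move=> M0 a0 XM; set Y := fun w => (N%:R^-1 * \sum_i X i w ^+ 2)%R.
have N0 : 0 <= (N%:R : R)^-1 by rewrite invr_ge0 ler0n.
have mX i : measurable_fun setT (fun w => X i w ^+ 2).
  by apply: measurable_funX.
have mY : measurable_fun setT Y.
  by apply: measurable_funM => //; apply: measurable_sum.
have Y0 w : 0 <= Y w by rewrite mulr_ge0 // sumr_ge0 // => i _; rewrite sqr_ge0.
have mEY : measurable_fun setT (EFin \o Y) by exact: measurableT_comp.
have := le_integral_abse P measurableT mEY a0.
rewrite setTI /=.
have -> : [set w | (a%:E <= `|(Y w)%:E|)%E] = [set w | a <= Y w].
  by apply/seteqP; split=> w /=; rewrite lee_fin ger0_norm.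
have -> : (\int[P]_w `|(Y w)%:E| =
    (N%:R^-1)%:E * \sum_i \int[P]_w (X i w ^+ 2)%:E)%E.
  have mE i : measurable_fun setT (fun w => (X i w ^+ 2)%:E).
    exact: measurableT_comp.
  have E0 i w : (0 <= (X i w ^+ 2)%:E)%E by rewrite lee_fin sqr_ge0.
  rewrite -ge0_integral_sum // -ge0_integralZl ?lee_fin //.
  - by apply: eq_integral => w _; rewrite gee0_abs ?lee_fin // sumEFin -EFinM.
  - exact: emeasurable_sum.
  - by move=> w _; exact: sume_ge0.
move=> le_aP; rewrite EFinM lee_pdivlMr // muleC.
apply: le_trans le_aP _.
apply: (@le_trans _ _ ((N%:R^-1)%:E * \sum_(i < N) M%:E)%E).
  by rewrite lee_wpmul2l ?lee_fin //; apply: lee_sum => i _.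
rewrite sumEFin -EFinM lee_fin sumr_const card_ord -[M *+ N]mulr_natl.
have [->|n0] := eqVneq N 0%N; first by rewrite invr0 mul0r.
by rewrite mulKf // pnatr_eq0.
Qed.

(** The exceptional event [E] may depend on [tau]: bounding [u n] costs a
    probability that vanishes, while boundedness in probability of a second
    quantity costs an arbitrarily small but fixed [tau]. *)
Lemma cvg_prob0 (A : nat -> set T) (u : nat -> {RV P >-> R}) (eps : R) :
  (forall n, measurable (A n)) -> 0 < eps ->
  cvg_in_prob P (fun n => u n : T -> R) 0 ->
  (forall tau, 0 < tau -> \forall n \near \oo, exists2 E : set T,
     measurable E /\ (P E <= tau%:E)%E &
     A n `<=` [set w | eps <= `|u n w|] `|` E) ->
  P (A n) @[n --> \oo] --> 0%E.
Proof.
move=> mA eps0 /(_ _ eps0) ucvg AE.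
have mU n : measurable [set w | eps <= `|u n w|].
  by apply: measurable_ge; exact: measurableT_comp.
have Psmall tau : 0 < tau -> \forall n \near \oo, (P (A n) <= tau%:E)%E.
  move=> tau0; have tau2 : 0 < tau / 2 by rewrite divr_gt0.
  have /fine_cvgP[_ /cvgrPdist_le/(_ _ tau2) usmall] := ucvg.
  near=> n.
  have [E [mE PE] sub] : exists2 E : set T,
      measurable E /\ (P E <= (tau / 2)%:E)%E &
      A n `<=` [set w | eps <= `|u n w|] `|` E.
    by near: n; exact: AE.
  apply: (@le_trans _ _ (P ([set w | eps <= `|u n w|] `|` E))).
    by apply: le_measure; rewrite ?inE //; exact: measurableU.
  apply: le_trans (measureU2 _ _ _) _ => //.
  rewrite [tau]splitr EFinD; apply: leeD => //.
  have : `|0 - fine (P [set w | eps <= `|u n w - 0|])| <= tau / 2 by near: n.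
  rewrite sub0r normrN; under eq_set do rewrite subr0.
  move/(le_trans (ler_norm _)).
  by rewrite -lee_fin fineK // fin_num_measure.
apply/fine_cvgP; split; first by near=> n; rewrite fin_num_measure.
apply/cvgrPdist_le => tau tau0; near=> n.
rewrite sub0r normrN ger0_norm ?fine_ge0 // -lee_fin fineK ?fin_num_measure //.
by near: n; exact: Psmall.
Unshelve. all: by end_near. Qed.

End Probability.

Theorem corollary2 (R : realType) (dT : measure_display)
    (T : measurableType dT) (P : probability T R)
    (d p q : nat) (d_gt0 : (0 < d)%N) (p_gt0 : (0 < p)%N) (q_gt0 : (0 < q)%N)
    (D : set 'rV[R]_d) (Z : 'I_p -> 'rV[R]_d -> {RV P >-> R})
    (Z_gaussian : gaussian_process D Z)
    (Z_stationary : stationary_process D Z)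
    (Z_zero_mean : zero_mean D Z)
    (theta_inf theta_sup : R) (theta_inf_sup : theta_inf < theta_sup)
    (c : 'I_p -> 'I_p -> 'rV[R]_d -> 'rV[R]_q -> R)
    (c_cov : forall t, box theta_inf theta_sup t ->
       stationary_matrix_cov (fun k l h => c k l h t))
    (theta0 : 'rV[R]_q)
    (theta0_interior : forall i, theta_inf < theta0 0 i < theta_sup)
    (c_theta0 : forall k l (s h : 'rV[R]_d), D s -> D (s + h) ->
       covariance P (Z k s) (Z l (s + h)) = (c k l h theta0)%:E)
    (tap : 'I_p -> 'I_p -> 'rV[R]_d -> R)
    (tap_cov : stationary_matrix_cov tap)
    (tap_support : forall k l h, 1 <= eucl_norm h -> tap k l h = 0)
    (gamma : nat -> R) (gamma_gt0 : forall n, 0 < gamma n)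
    (x : nat -> 'rV[R]_d) (x_in_D : forall a, D (x a)) (x_inj : injective x) :
  let Theta : set 'rV[R]_q := box theta_inf theta_sup in
  let L n t (w : T) := scaled_nll (Sigma x c n t) (obs x Z n w) in
  let Lbar n t (w : T) := scaled_nll (K x c tap gamma n t) (obs x Z n w) in
  smooth_decay_condition Theta c ->
  taper_condition tap gamma ->
  minimal_distance_condition x ->
  minimal_eigenvalue_condition Theta x c tap gamma ->
  (forall kappa : R, 0 < kappa -> exists2 epsilon : R, 0 < epsilon &
     exists2 u : nat -> {RV P >-> R}, cvg_in_prob P (fun n => u n : T -> R) 0 &
       forall n w, (0 < n)%N ->
         ((epsilon + u n w)%:E <=
          ereal_inf [set (L n t w)%:E | t in
                       [set t | Theta t /\ (kappa <= `|t - theta0|)%R]] -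
          (L n theta0 w)%:E)%E) ->
  forall hatML hattML : nat -> T -> 'rV[R]_q,
  (forall n i, measurable_fun setT (fun w => hatML n w 0 i)) ->
  (forall n i, measurable_fun setT (fun w => hattML n w 0 i)) ->
  (forall n w, (0 < n)%N -> is_argmin Theta (fun t => L n t w) (hatML n w)) ->
  (forall n w, (0 < n)%N ->
     is_argmin Theta (fun t => Lbar n t w) (hattML n w)) ->
  cvg_in_prob P hatML theta0 /\ cvg_in_prob P hattML theta0.

Proof.
move=> Theta L Lbar decay taper sep [delta [d0 eig]] ident hatML hattML mML mtML
  argML argtML.
have mdist (X : nat -> T -> 'rV[R]_q) (e : R) n :
    (forall m i, measurable_fun setT (fun w => X m w 0 i)) ->
    measurable [set w | e <= `|X n w - theta0|].
  by move=> mX; apply: measurable_ge; apply: measurable_dist; exact: mX.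
have Theta0 : Theta theta0.
  by move=> i; have /andP[/ltW-> /ltW->] := theta0_interior i.
have gap (X : nat -> T -> 'rV[R]_q) kappa eps (u : nat -> {RV P >-> R}) :
    (forall n w, (0 < n)%N ->
      ((eps + u n w)%:E <=
       ereal_inf [set (L n t w)%:E | t in
                    [set t | Theta t /\ (kappa <= `|t - theta0|)%R]] -
       (L n theta0 w)%:E)%E) ->
    forall n w, (0 < n)%N -> Theta (X n w) -> kappa <= `|X n w - theta0| ->
      eps + u n w <= L n (X n w) w - L n theta0 w.
  move=> H n w n0 TX kX; rewrite -lee_fin EFinB; apply: le_trans (H n w n0) _.
  apply: leeB => //; apply: ereal_inf_lbound.
  by exists (X n w).
split=> kappa kappa0; have [eps eps0 [u ucvg uP]] := ident kappa kappa0.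
  apply: (cvg_prob0 (u := u) (eps := eps)) => // [n|tau tau0].
    exact: mdist.
  near=> n; have n0 : (0 < n)%N by near: n; exact: nbhs_infty_gt.
  exists set0; first by rewrite measure0 lee_fin ltW.
  move=> w /= kw; left; have [TX /(_ _ Theta0) LX] := argML n w n0.
  have := gap hatML _ _ _ uP n w n0 TX kw.
  rewrite -normrN => h; apply: le_trans _ (ler_norm _).
  by move: LX h; rewrite -subr_le0; lra.
have eps2 : 0 < eps / 2 by rewrite divr_gt0.
apply: (cvg_prob0 (u := u) (eps := eps / 2)) => // [n|tau tau0].
  exact: mdist.
pose M := 1 + \sum_k `|c k k 0 theta0|.
have M0 : 0 < M by rewrite ltr_pwDl // sumr_ge0.
(* outside an event of probability at most M / a = tau the mean square is below
   a, and then eta S bounds the tapering error by eps / 4 both at theta0 and at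
   the estimator *)
pose a := M / tau.
have a0 : 0 < a by rewrite divr_gt0.
pose S := delta^-1 + delta ^- 2 * a.
have S0 : 0 < S by rewrite addr_gt0 ?mulr_gt0 ?invr_gt0 ?exprn_gt0.
pose eta := eps / (4 * S).
have eta0 : 0 < eta by rewrite divr_gt0 // mulr_gt0.
have rows := row_sums_taper d_gt0 q_gt0 gamma_gt0 decay taper sep eta0.
near=> n; have n0 : (0 < n)%N by near: n; exact: nbhs_infty_gt.
pose X (i : 'I_(p * n)) := Z (component i) (x (location i)).
pose W w := (p * n)%:R^-1 * \sum_i X i w ^+ 2.
have second_moment i : (\int[P]_w (X i w ^+ 2)%:E <= M%:E)%E.
  rewrite /X; set k := component i; set s := x (location i).
  have Ds : D s by exact: x_in_D.
  have := @c_theta0 k k s 0; rewrite addr0 => /(_ Ds Ds).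
  rewrite unlock (Z_zero_mean k s Ds) /= unlock => cE.
  rewrite (_ : (\int[P]_w _)%E = (c k k 0 theta0)%:E); last first.
    by rewrite -cE; apply: eq_integral => w _; rewrite mulrfctE /= subr0 expr2.
  rewrite lee_fin /M (bigD1 k) //= addrCA.
  apply: le_trans (ler_norm _) _; rewrite lerDl addr_ge0 // sumr_ge0 //.
exists [set w | a <= W w].
  split.
    apply: measurable_ge; apply: measurable_funM => //.
    by apply: measurable_sum => i; apply: measurable_funX.
  have -> : tau = M / a by rewrite /a invf_div mulrCA divff ?mulr1 // gt_eqF.
  apply: mean_square_markov => //; exact: ltW.
move=> w /= kw; have [TX /(_ _ Theta0) LX] := argtML n w n0.
have := gap hattML _ _ _ uP n w n0 TX kw.
have [//|Wa] := leP a (W w); first by right.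
move=> Lgap; left => /=.
have close t : Theta t -> `|L n t w - Lbar n t w| <= eps / 4.
  move=> Tt; have [dS dK] := eig n n0 t Tt.
  have rt : forall t, Theta t -> forall i,
    \sum_j `|(Sigma x c n t - K x c tap gamma n t) i j| <= eta by near: n.
  apply: le_trans (scaled_nll_taper_close (obs x Z n w) p_gt0 n0 (c_cov t Tt)
    tap_cov d0 dS dK (ltW eta0) (rt t Tt)) _.
  have -> : eps / 4 = eta * S by rewrite /eta; field; rewrite gt_eqF.
  rewrite ler_wpM2l ?(ltW eta0) // lerD2l ler_wpM2l //.
    by rewrite invr_ge0 exprn_ge0 // ltW.
  rewrite (_ : sqnorm _ = \sum_i X i w ^+ 2) ?ltW //.
  by apply: eq_bigr => i _; rewrite mxE.
have := close _ TX; have := close _ Theta0.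
rewrite !ler_norml => /andP[? ?] /andP[? ?].
rewrite -normrN; apply: le_trans _ (ler_norm _).
move: LX; lra.
Unshelve. all: by end_near. Qed.
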